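(* Let $k$ be a field, let $H_4$ be the graph on the 12 vertices $v_{i,j}$ ($i\in\{0,1,2,3\}$, $j\in\mathbb Z_3$) in which $v_{i,j}v_{i,j'}$ is an edge for all $i$ and $j\ne j'$, $v_{i,j}v_{i+1,j}$ is an edge for $0\le i\le 2$, and $v_{0,j}v_{3,-j}$ is an edge for all $j\in\mathbb Z_3$ (no other edges). Identify the vertices with the variables of the polynomial ring $R=k[x_1,\dots,x_{12}]$, and let $J=J(H_4)\subseteq R$ be the cover ideal of $H_4$. Then $J$ does not have the persistence property, i.e. there exists $s\ge 1$ with $\mathrm{Ass}(J^s)\not\subseteq \mathrm{Ass}(J^{s+1})$.
   Context: A transversal (vertex cover) of a graph $G$ is a set $T\subseteq V(G)$ meeting every edge. The cover ideal $J(G)$ is the ideal generated by the square-free monomials $\prod_{x\in T}x$ over all inclusion-wise minimal transversals $T$ of $G$. For an ideal $I$ of a Noetherian commutative ring $R$, $\mathrm{Ass}(I)$ is the set of prime ideals of the form $I:\langle m\rangle$ for some $m\in R$; $I$ has the persistence property if $\mathrm{Ass}(I^s)\subseteq\mathrm{Ass}(I^{s+1})$ for all $s\ge 1$. *)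

(* Defs.v *)
From HB Require Import structures.
From mathcomp Require Import all_boot all_order all_algebra.
From mathcomp Require Import mpoly.

Set Implicit Arguments.
Unset Strict Implicit.
Unset Printing Implicit Defensive.

Import GRing.Theory.
Local Open Scope ring_scope.

(* Ideals are Prop-valued predicates, compared extensionally; MathComp's own
   [idealr_closed] is about boolean predicates, which would force membership in
   a generated ideal or in a colon ideal to be decidable. *)
Section Ideals.
Variable R : comNzRingType.
Implicit Types (S I J P : R -> Prop) (m : R).

Definition is_ideal I : Prop :=
  [/\ I 0, forall a b, I a -> I b -> I (a + b) & forall r a, I a -> I (r * a)].

Definition ideal_gen S : R -> Prop :=
  fun x => forall I, is_ideal I -> (forall y, S y -> I y) -> I x.

Definition ideal_mul I J : R -> Prop :=
  ideal_gen (fun x => exists a b, [/\ I a, J b & x = a * b]).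

Fixpoint ideal_exp I (s : nat) : R -> Prop :=
  if s is s'.+1 then ideal_mul I (ideal_exp I s') else fun=> True.

Definition colon I J : R -> Prop := fun r => forall a, J a -> I (r * a).

Definition principal m : R -> Prop := ideal_gen (fun x => x = m).

Definition prime_ideal P : Prop :=
  [/\ is_ideal P, ~ P 1 & forall a b, P (a * b) -> P a \/ P b].

Definition Ass I : (R -> Prop) -> Prop :=
  fun P => prime_ideal P /\ exists m, forall x, P x <-> colon I (principal m) x.

Definition Ass_subset I J : Prop := forall P, Ass I P -> Ass J P.

Definition persistence_property I : Prop :=
  forall s : nat, (1 <= s)%N -> Ass_subset (ideal_exp I s) (ideal_exp I s.+1).

End Ideals.

(* [mpoly] shadows [symmetric], hence the qualified name. *)
Record sgraph (V : finType) := SGraph {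
  adj :> rel V;
  adj_sym : ssrbool.symmetric adj;
  adj_irrefl : irreflexive adj }.

Section CoverIdeal.
Variables (k : fieldType) (V : finType) (G : sgraph V).

Definition transversal (T : {set V}) : bool :=
  [forall x, forall y, G x y ==> (x \in T) || (y \in T)].

(* The vertex [x] is identified with the variable of index [enum_rank x]. *)
Definition cover_monomial (T : {set V}) : {mpoly k[#|V|]} :=
  \prod_(x in T) 'X_(enum_rank x).

Definition cover_ideal : {mpoly k[#|V|]} -> Prop :=
  ideal_gen (fun p => exists2 T, minset transversal T & p = cover_monomial T).

End CoverIdeal.

Arguments cover_ideal k {V} G.

(* The vertex v_{i,j} is the pair (i, j). *)
Definition H4_vertex : finType := ('I_4 * 'Z_3)%type.

Lemma card_H4_vertex : #|H4_vertex| = 12%N.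
Proof. by rewrite card_prod !card_ord. Qed.

(* Each edge of H_4, in at least one of its two orientations. *)
Definition H4_arc (u v : H4_vertex) : bool :=
  [|| (u.1 == v.1) && (u.2 != v.2),
      (v.1 == u.1.+1 :> nat) && (u.2 == v.2)
    | [&& u.1 == 0 :> nat, v.1 == 3 :> nat & v.2 == - u.2]].

Definition H4_adj (u v : H4_vertex) : bool := H4_arc u v || H4_arc v u.

Lemma H4_adj_sym : ssrbool.symmetric H4_adj.
Proof. by move=> u v; rewrite /H4_adj orbC. Qed.

Lemma H4_adj_irrefl : irreflexive H4_adj.
Proof.
move=> [i j]; rewrite /H4_adj /H4_arc orbb /= !eqxx /= ltn_eqF //=.
by case: (nat_of_ord i).
Qed.

Definition H4 : sgraph H4_vertex := SGraph H4_adj_sym H4_adj_irrefl.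

(* Main.v *)
Require Import Defs.
From mathcomp Require Import all_boot all_order all_algebra.
From mathcomp Require Import mpoly.
From mathcomp Require Import zify.

(** A polynomial lies in [J^s] iff each of its monomials [x^a] dominates a
    product of [s] transversals.  Passing to complements, this asks for [s]
    independent sets that cover every vertex [v] at least [s - a_v] times.

    [H_4] is 4-critical: it is not 3-colourable but every vertex-deleted
    subgraph is.  Hence [J^3 : x_1^2 ... x_12^2] is the maximal ideal [P].

    If [P = J^4 : f], then some monomial [x^a] of [f] is not in [J^4] although
    every [x_v x^a] is.  Then each [a_v <= 3], and as a transversal contains two
    vertices of each triangle, at most one vertex [w_i] of the [i]-th triangle
    has exponent 2, all others having exponent 3.  So one has to 4-colour [H_4]
    with the vertices [w_i] receiving two colours.  A finite check shows that
    this is possible unless the [w_i] exist in all four triangles and avoid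
    [v_{i,0}]; and that in each of the impossible cases it remains impossible
    after deleting [v_{0,0}], contradicting [x_{0,0} x^a \in J^4]. *)

Set Implicit Arguments.
Unset Strict Implicit.
Unset Printing Implicit Defensive.

Import GRing.Theory.
Local Open Scope ring_scope.

(** * Ideals, their powers and colon ideals *)

Section IdealTheory.
Variable R : comNzRingType.
Implicit Types (S I J : R -> Prop).

Lemma ideal_gen_sub S x : S x -> ideal_gen S x.
Proof. by move=> Sx I _; apply. Qed.

Lemma ideal_gen_ideal S : is_ideal (ideal_gen S).
Proof.
split=> [I [] //|a b Sa Sb I idI SI|r a Sa I idI SI]; case: (idI) => _ ID IM.
  by apply: ID; [apply: Sa | apply: Sb].
by apply: IM; apply: Sa.
Qed.

Lemma ideal_exp_ideal I s : is_ideal (ideal_exp I s).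
Proof. by case: s => [|s] //=; apply: ideal_gen_ideal. Qed.

Lemma ideal_sum I (T : eqType) (r : seq T) (F : T -> R) :
  is_ideal I -> (forall x, x \in r -> I (F x)) -> I (\sum_(x <- r) F x).
Proof. by case=> I0 ID _ IF; rewrite big_seq; elim/big_ind: _. Qed.

Lemma colon_principal I m x :
  is_ideal I -> colon I (principal m) x <-> I (x * m).
Proof.
move=> idI; case: (idI) => I0 ID IM.
split=> [|Ixm a]; first by apply; apply: ideal_gen_sub.
move/(_ (fun b => I (x * b))); apply=> [|_ -> //].
split=> [|b c Ib Ic|r b Ib]; first by rewrite mulr0.
  by rewrite mulrDr; apply: ID.
by rewrite mulrCA; apply: IM.
Qed.

End IdealTheory.

(** * Monomial conditions and the ideal of the variables *)

Section MonomialIdeals.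
Variables (k : fieldType) (n : nat).
Implicit Types (p : {mpoly k[n]}) (m : 'X_{1..n}).

Lemma monomial_ideal (P : 'X_{1..n} -> Prop) :
  (forall m m', P m -> P (m' + m)%MM) ->
  is_ideal (fun p => forall m, m \in msupp p -> P m).
Proof.
move=> Pup; split=> [m|p q Pp Pq m /msuppD_le|r p Pp m /msuppM_le].
- by rewrite mcoeff_msupp mcoeff0 eqxx.
- by rewrite mem_cat => /orP[/Pp|/Pq].
- by case/allpairsP=> -[m1 m2] [_ /= /Pp Pm2 ->]; apply: Pup.
Qed.

(** This is the ideal generated by the variables; it is the kernel of a ring morphism to a field. *)
Lemma mcoeff0_prime : prime_ideal (fun p => p@_0%MM = 0).
Proof.
split; first split.
- by rewrite mcoeff0.
- by move=> a b a0 b0; rewrite mcoeffD a0 b0 addr0.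
- by move=> r a a0; rewrite rmorphM /= a0 mulr0.
- by rewrite mcoeff1 eqxx; apply/eqP/oner_neq0.
- by move=> a b /eqP; rewrite rmorphM mulf_eq0 => /orP[]/eqP; [left | right].
Qed.

End MonomialIdeals.

(** * Powers of cover ideals in terms of transversals *)

Section CoverIdealPowers.
Variables (k : fieldType) (V : finType) (G : sgraph V).
Implicit Types (T : {set V}) (m : 'X_{1..#|V|}).

Definition cover_mnm T : 'X_{1..#|V|} :=
  [multinom (enum_val i \in T : nat) | i < #|V|].

Lemma cover_mnmE T v : cover_mnm T (enum_rank v) = (v \in T).
Proof. by rewrite mnmE enum_rankK. Qed.

Lemma cover_monomialE T : cover_monomial k T = 'X_[cover_mnm T].
Proof.
rewrite mpolyXE_id (reindex _ (onW_bij _ (@enum_rank_bij V))) /=.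
rewrite /cover_monomial big_mkcond; apply: eq_bigr => v _.
by rewrite cover_mnmE; case: ifP.
Qed.

(** The transversals need not be minimal: shrinking one only lowers the counts. *)
Definition covered s m := exists Ts : seq {set V},
  [/\ size Ts = s, all (Defs.transversal G) Ts
    & forall v, (count (fun T => v \in T) Ts <= m (enum_rank v))%N].

Lemma covered_add s t m m' :
  covered s m -> covered t m' -> covered (s + t) (m + m')%MM.
Proof.
case=> [Ts [<- trT leT]] [Us [<- trU leU]]; exists (Ts ++ Us); split=> [||v].
- by rewrite size_cat.
- by rewrite all_cat trT.
- by rewrite count_cat mnmDE leq_add.
Qed.

Lemma covered0 m : covered 0 m. Proof. by exists [::]. Qed.

Lemma cover_ideal_covered p : cover_ideal k G p ->
  forall m, m \in msupp p -> covered 1 m.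
Proof.
move/(_ (fun p => forall m, m \in msupp p -> covered 1 m)).
apply=> [|_ [T minT ->] m]; first apply: monomial_ideal => m m' cm.
  exact: covered_add (covered0 m') cm.
rewrite cover_monomialE msuppX inE => /eqP->.
exists [:: T]; split=> //= [|v]; first by rewrite (minsetp minT).
by rewrite addn0 cover_mnmE.
Qed.

Lemma covered_ideal_exp s m :
  covered s m -> ideal_exp (cover_ideal k G) s 'X_[m].
Proof.
elim: s m => // s IHs m [[|T Ts] [//= [sTs] /andP[trT trTs] leT]].
have [B minB sBT] := minset_exists trT.
have BmE v : ((v \in B) + count (fun T => v \in T) Ts <= m (enum_rank v))%N.
  apply: leq_trans (leT v); rewrite leq_add2r.
  by case vB: (v \in B); rewrite // (subsetP sBT).
have leB : (cover_mnm B <= m)%MM.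
  apply/mnm_lepP => i; rewrite -[i]enum_valK cover_mnmE.
  by apply: leq_trans (BmE _); apply: leq_addr.
rewrite -(submK leB) addmC mpolyXD /=; apply: ideal_gen_sub.
exists 'X_[cover_mnm B], 'X_[m - cover_mnm B]; split=> //.
  by apply: ideal_gen_sub; exists B; rewrite ?cover_monomialE.
apply: IHs; exists Ts; split=> // v.
by rewrite mnmBE cover_mnmE leq_subRL ?BmE // (leq_trans _ (BmE v)) ?leq_addr.
Qed.

(** Being covered is upward closed, so the polynomials with only covered monomials form an ideal,
    which contains the generating products. Conversely, minimal transversals inside the given ones
    are split off one at a time. *)
Lemma ideal_exp_coverP s p :
  ideal_exp (cover_ideal k G) s p <-> forall m, m \in msupp p -> covered s m.
Proof.
split=> [|cov_p]; last first.
  rewrite [p]mpolyE; apply: ideal_sum (ideal_exp_ideal _ _) _ => m /cov_p cm.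
  have [_ _ IM] := ideal_exp_ideal (cover_ideal k G) s.
  by rewrite -mul_mpolyC; apply: IM; apply: covered_ideal_exp.
elim: s p => [|s IHs] p; first by move=> _ m _; apply: covered0.
move/(_ (fun p => forall m, m \in msupp p -> covered s.+1 m)).
apply=> [|_ [a [b [Ia Jb ->]]] m /msuppM_le].
  by apply: monomial_ideal => m m' cm; apply: covered_add (covered0 m') cm.
case/allpairsP=> -[m1 m2] [/= am1 bm2 ->]; rewrite -add1n.
by apply: covered_add; [apply: cover_ideal_covered am1 | apply: IHs bm2].
Qed.

End CoverIdealPowers.

(** * Finite colouring searches on [H4] *)

(* A word lists, for one triangle, the vertex taken in each colour, the letter 3
   meaning that the colour is not used on the triangle. *)
Fixpoint words (n : nat) : seq (seq nat) :=
  if n is n'.+1 then [seq x :: r | x <- iota 0 4, r <- words n'] else [:: [::]].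

Lemma mem_words n r : (r \in words n) = (size r == n) && all (fun x => x < 4)%N r.
Proof.
elim: n r => [|n IHn] r; first by case: r.
have -> : words n.+1 = [seq x :: q | x <- iota 0 4, q <- words n] by [].
apply/allpairsP/andP => [[[x q] [xI]]|[]].
  rewrite IHn => /andP[/eqP<- q4] -> /=; rewrite q4 andbT.
  by move: xI; rewrite mem_iota.
case: r => // x r /= sr /andP[x4 r4]; exists (x, r).
split=> //=; first by case: x x4 {sr} => [|[|[|[]]]].
by rewrite IHn r4 andbT.
Qed.

(** [d j] is the number of colours demanded at vertex [j] of the triangle. *)
Definition rows (n : nat) (d : nat -> nat) : seq (seq nat) :=
  [seq r <- words n | all (fun j => d j <= count_mem j r)%N (iota 0 3)].

(* [straight] and [twisted] say that two words use no colour on both ends of an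
   edge [v_{i,j} v_{i+1,j}], respectively [v_{0,j} v_{3,-j}]. *)
Definition straight n (r r' : seq nat) :=
  all (fun c => (nth 3 r c == 3) || (nth 3 r c != nth 3 r' c))%N (iota 0 n).

Definition twisted n (r r' : seq nat) :=
  all (fun c => (nth 3 r c == 3) || ((3 - nth 3 r c) %% 3 != nth 3 r' c))%N
    (iota 0 n).

Definition search n (R0 R1 R2 R3 : seq (seq nat)) : bool :=
  has (fun r0 => has (fun r1 => has (fun r2 => has (fun r3 => twisted n r0 r3)
    [seq r <- R3 | straight n r2 r]) [seq r <- R2 | straight n r1 r])
    [seq r <- R1 | straight n r0 r]) R0.

Definition colorable (n : nat) (d : nat -> nat -> nat) : bool :=
  search n (rows n (d 0)) (rows n (d 1)) (rows n (d 2)) (rows n (d 3)).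

Lemma H4_not3col : ~~ colorable 3 (fun _ _ => 1%N).
Proof. by vm_compute. Qed.

(** Demand 0 at a vertex amounts to deleting it. *)
Lemma H4_3crit : all (fun i => all (fun j =>
  colorable 3 (fun i' j' => ~~ ((i' == i) && (j' == j)))) (iota 0 3)) (iota 0 4).
Proof. by vm_compute. Qed.

Definition all4 (f : nat -> nat -> nat -> nat -> bool) : bool :=
  all (fun x0 => all (fun x1 => all (fun x2 => all (f x0 x1 x2)
    (iota 0 3)) (iota 0 3)) (iota 0 3)) (iota 0 3).

Lemma all4P f x0 x1 x2 x3 : (x0 < 3)%N -> (x1 < 3)%N -> (x2 < 3)%N ->
  (x3 < 3)%N -> all4 f -> f x0 x1 x2 x3.
Proof.
move=> lt0 lt1 lt2 lt3 /allP f0; have I x : (x < 3)%N -> x \in iota 0 3.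
  by rewrite mem_iota.
by apply: (allP (allP (allP (f0 x0 _) x1 _) x2 _) x3); apply: I.
Qed.

(* The explicit [if] instead of [||] avoids the second search under call by
   value, and the tables of rows are abstracted so that they are computed once. *)
Definition dichotomy (row row' : nat -> seq (seq nat)) x0 x1 x2 x3 : bool :=
  if search 4 (row x0) (row x1) (row x2) (row x3) then true
  else [&& 0 < x0, 0 < x1, 0 < x2, 0 < x3
    & ~~ search 4 (row' x0) (row x1) (row x2) (row x3)]%N.

Lemma all4_dichotomy : exists row row' : nat -> seq (seq nat),
  [/\ forall x, (x < 3)%N -> row x = rows 4 (fun j => (j == x).+1),
      forall x, (x < 3)%N -> row' x = rows 4 (fun j => (j == x).+1 - (j == 0))%N
    & all4 (dichotomy row row')].
Proof.
exists (nth [::] [seq rows 4 (fun j => (j == x).+1) | x <- iota 0 3]).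
exists (nth [::] [seq rows 4 (fun j => (j == x).+1 - (j == 0))%N | x <- iota 0 3]).
split=> [x x3|x x3|]; last by vm_compute.
  by rewrite (nth_map 0%N) ?size_iota ?nth_iota ?add0n.
by rewrite (nth_map 0%N) ?size_iota ?nth_iota ?add0n.
Qed.

Definition twice (w : nat -> nat) (i j : nat) : nat := (j == w i).+1.

Lemma H4_dichotomy w : (forall i, w i < 3)%N ->
  colorable 4 (twice w) \/ (forall i, (i < 4)%N -> (0 < w i)%N) /\
    ~~ colorable 4 (fun i j => twice w i j - ((i == 0) && (j == 0)))%N.
Proof.
move=> w3; have [row [row' [rowE rowE' ]]] := all4_dichotomy.
move/(all4P (w3 0) (w3 1) (w3 2) (w3 3)).
rewrite /dichotomy (rowE _ (w3 0)) (rowE _ (w3 1)) (rowE _ (w3 2)).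
rewrite (rowE _ (w3 3)) (rowE' _ (w3 0)) /colorable.
case: ifP => [|_]; first by left.
case/and5P=> w0 w1 w2 w3' ns; right; split; last exact: ns.
by case=> [|[|[|[|]]]].
Qed.

(** * From covers of [H4] to multicolourings and back *)

Section H4Covers.
Implicit Types (T : {set H4_vertex}) (m : 'X_{1..#|H4_vertex|}).

Lemma transversal_adj T u v : Defs.transversal H4 T -> H4_adj u v ->
  u \notin T -> v \in T.
Proof. by move=> /forallP/(_ u)/forallP/(_ v)/implyP trT /trT/orP[->|]. Qed.

Definition missed T (i : 'I_4) : nat :=
  find (fun j => (i, inord j : 'Z_3) \notin T) (iota 0 3).

Lemma missedP T v : Defs.transversal H4 T ->
  (v \notin T) = (missed T v.1 == v.2 :> nat).
Proof.
case: v => i j trT /=.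
have row a b : (a < 3)%N -> (b < 3)%N -> a != b ->
    ((i, inord a : 'Z_3) \in T) || ((i, inord b : 'Z_3) \in T).
  move=> a3 b3 ab; apply/orP; case: (boolP (_ \in T)) => [|aT]; [by left | right].
  apply: transversal_adj trT _ aT.
  by rewrite /H4_adj /H4_arc /= eqxx -val_eqE /= !inordK // ab.
have := row 0 1 isT isT isT; have := row 0 2 isT isT isT.
have := row 1 2 isT isT isT; rewrite /missed /= -[j in LHS]inord_val.
by case: j => -[|[|[|//]]] /= _; do 3!case: (_ \in T).
Qed.

Lemma missed_lt4 T i : (missed T i < 4)%N.
Proof. by rewrite ltnS -[3%N](size_iota 0); apply: find_size. Qed.

Lemma missed_adj T i i' j j' : Defs.transversal H4 T ->
  H4_adj (i, j) (i', j') -> missed T i = j -> missed T i' != j'.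
Proof.
move=> trT adj_ij Ti; have := missedP (i', j') trT; rewrite /= => <-.
rewrite negbK; apply: (transversal_adj trT adj_ij).
by rewrite (missedP _ trT) Ti.
Qed.

Lemma all_iota_Z3 (P : nat -> bool) :
  (forall j : 'Z_3, P j) -> all P (iota 0 3).
Proof.
by move=> Pj; apply/allP => j; rewrite mem_iota => j3; apply: (Pj (Ordinal j3)).
Qed.

(** The colour classes are the complements of the transversals: at most [m_v] of the [n]
    transversals contain [v], so at least [n - m_v] miss it. *)
Lemma covered_colorable n m (d : nat -> nat -> nat) : covered H4 n m ->
  (forall v : H4_vertex, d v.1 v.2 <= n - m (enum_rank v))%N -> colorable n d.
Proof.
case=> Ts [sTs trTs leT] led.
pose r i := [seq missed T i | T <- Ts].
have rR (i : 'I_4) : r i \in rows n (d i).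
  rewrite mem_filter mem_words size_map sTs eqxx /= andbC; apply/andP; split.
    by rewrite all_map; apply/allP => T _; apply: missed_lt4.
  have rj (j : 'Z_3) : (d i j <= count_mem (j : nat) (r i))%N.
    apply: leq_trans (led (i, j)) _; rewrite leq_subLR.
    rewrite -sTs -(count_predC (fun T => (i, j) \in T)) leq_add ?leT //.
    rewrite count_map leq_eqVlt; apply/orP; left; apply/eqP.
    apply: eq_in_count => T /(allP trTs) trT /=.
    by rewrite (missedP (i, j)).
  exact: (all_iota_Z3 (P := fun j => d i j <= count_mem j (r i))%N rj).
have trc c : (c < n)%N -> Defs.transversal H4 (nth set0 Ts c).
  by move=> cn; apply: (allP trTs); rewrite mem_nth ?sTs.
have nthr i c : (c < n)%N -> nth 3 (r i) c = missed (nth set0 Ts c) i.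
  by move=> cn; rewrite (nth_map set0) ?sTs.
have str (i i' : 'I_4) : i' = i.+1 :> nat -> straight n (r i) (r i').
  move=> ii'; apply/allP => c; rewrite mem_iota add0n => cn; rewrite !nthr //.
  have := missed_lt4 (nth set0 Ts c) i; rewrite ltnS leq_eqVlt => /orP[->//|x3].
  apply/orP; right; rewrite eq_sym; rewrite -[missed _ i]/(Ordinal x3 : nat).
  apply: (missed_adj (trc c cn) _ (erefl : missed _ i = Ordinal x3)).
  by rewrite /H4_adj /H4_arc /= ii' !eqxx !orbT.
have tw : twisted n (r ord0) (r (inord 3)).
  apply/allP => c; rewrite mem_iota add0n => cn; rewrite !nthr //.
  have := missed_lt4 (nth set0 Ts c) ord0; rewrite ltnS leq_eqVlt => /orP[->//|x3].
  apply/orP; right; rewrite eq_sym.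
  apply: (missed_adj (j' := - (Ordinal x3 : 'Z_3)) (trc c cn) _
            (erefl : missed _ ord0 = Ordinal x3)).
  by rewrite /H4_adj /H4_arc /= inordK // !eqxx !orbT.
have r0 := rR ord0; have r1 := rR (inord 1); have r2 := rR (inord 2).
have r3 := rR (inord 3); rewrite !inordK // in r1 r2 r3.
apply/hasP; exists (r ord0) => //; apply/hasP; exists (r (inord 1)).
  by rewrite mem_filter r1 str // inordK.
apply/hasP; exists (r (inord 2)); first by rewrite mem_filter r2 str // !inordK.
by apply/hasP; exists (r (inord 3)); first by rewrite mem_filter r3 str // !inordK.
Qed.

Lemma colorable_covered n m (d : nat -> nat -> nat) : colorable n d ->
  (forall v : H4_vertex, n - m (enum_rank v) <= d v.1 v.2)%N -> covered H4 n m.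
Proof.
case/hasP=> r0 R0 /hasP[r1]; rewrite mem_filter => /andP[s01 R1] /hasP[r2].
rewrite mem_filter => /andP[s12 R2] /hasP[r3]; rewrite mem_filter.
case/andP=> s23 R3 t03 led; pose r := nth [::] [:: r0; r1; r2; r3].
have {R0 R1 R2 R3} rR (i : 'I_4) : r i \in rows n (d i).
  by case: i => -[|[|[|[|]]]].
have {s01 s12 s23} str (i i' : 'I_4) :
    i' = i.+1 :> nat -> straight n (r i) (r i').
  move=> ii'; move: (ltn_ord i'); rewrite ii'.
  by case: i {ii'} => -[|[|[|]]].
exists [seq [set v : H4_vertex | nth 3 (r v.1) c != v.2] | c <- iota 0 n].
split=> [||v]; first by rewrite size_map size_iota.
  rewrite all_map; apply/allP => c cI /=; apply/forallP => u; apply/forallP => v.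
  apply/implyP; rewrite !inE -negb_and => uv; apply/negP => /andP[/eqP uc /eqP vc].
  have arc a b : H4_arc a b ->
      nth 3 (r a.1) c = a.2 -> nth 3 (r b.1) c = b.2 -> False.
    move=> ab ac bc; case/or3P: ab => [/andP[/eqP ab2]|/andP[/eqP ab1 /eqP ab2]|].
    - by rewrite -val_eqE /= -ac -bc ab2 eqxx.
    - by have /allP/(_ c cI) := str _ _ ab1; rewrite ac bc ab2 eqxx orbF ltn_eqF.
    case/and3P=> /eqP a0 /eqP b3 /eqP ab2; move: t03 => /allP/(_ c cI).
    move: ac bc; rewrite a0 b3 ab2 /r /= => -> ->; rewrite /= eqxx orbF.
    by rewrite ltn_eqF.
  by case/orP: uv => /arc; [apply | move=> /(_ vc uc)].
move: (rR v.1); rewrite mem_filter mem_words => /andP[/allP cnt /andP[/eqP sr _]].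
have vI : (v.2 : nat) \in iota 0 3 by rewrite mem_iota /= ltn_ord.
have := leq_trans (led v) (cnt _ vI); rewrite leq_subLR addnC -leq_subLR.
apply: leq_trans; rewrite count_map -{1}sr.
rewrite -(mkseq_nth 3 (r v.1)) count_map /mkseq size_map size_iota sr.
rewrite -{2}(size_iota 0 n).
rewrite -(count_predC (fun c => nth 3 (r v.1) c == v.2) (iota 0 n)).
by rewrite addKn; apply: eq_leq; apply: eq_count => c /=; rewrite inE.
Qed.

Lemma covered_row n m (i : 'I_4) : covered H4 n m ->
  (n.*2 <= \sum_(j : 'Z_3) m (enum_rank ((i, j) : H4_vertex)))%N.
Proof.
case=> Ts [<- trTs leT].
apply: leq_trans (leq_sum _ (fun j _ => leT (i, j))).
elim: Ts trTs {leT} => [|T Ts IHTs] //= /andP[trT /IHTs leTs].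
rewrite big_split /= doubleS -[(_.*2).+2]add2n leq_add //.
rewrite (eq_bigr (fun j : 'Z_3 => (missed T i != j) : nat)) => [|j _].
  by rewrite !big_ord_recr big_ord0 /=; case: (missed T i) => [|[|[|]]].
by rewrite -(missedP (i, j) trT) negbK.
Qed.

Lemma covered4_of_succ m :
  (forall v : H4_vertex, covered H4 4 (m + U_(enum_rank v))%MM) -> covered H4 4 m.
Proof.
move=> cov.
have [/existsP[v mv]|] := boolP [exists v : H4_vertex, 4 <= m (enum_rank v)]%N.
  have [Ts [sTs trTs leT]] := cov v; exists Ts; split=> // u.
  have := leT u; rewrite mnmDE mnm1E (inj_eq enum_rank_inj).
  case: eqP => [<- _|_]; last by rewrite addn0.
  by apply: leq_trans mv; rewrite -sTs count_size.
rewrite negb_exists => /forallP m3.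
pose mu (i j : nat) := m (enum_rank ((inord i, inord j) : H4_vertex)).
have muE (v : H4_vertex) : m (enum_rank v) = mu v.1 v.2.
  by rewrite /mu !inord_val -surjective_pairing.
have mu3 i j : (mu i j <= 3)%N by rewrite -ltnS ltnNge m3.
have mu8 i : (i < 4)%N -> (8 <= mu i 0 + mu i 1 + mu i 2)%N.
  (* Multiplying by a variable of another triangle [i'] leaves the exponents of triangle [i]
     unchanged. *)
  move=> i4; pose i' : 'I_4 := inord (i == 0).
  have ii' : i' != inord i.
    by rewrite -val_eqE /= !inordK //; case: (i) => [|[|]].
  have := covered_row (inord i) (cov (i', ord0)).
  rewrite (eq_bigr (fun j : 'Z_3 => mu i j)) => [|j _].
    by rewrite !big_ord_recr big_ord0 /= add0n.
  rewrite mnmDE mnm1E (inj_eq enum_rank_inj) xpair_eqE (negPf ii') addn0.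
  by rewrite muE inordK.
(* By [mu3] and [mu8] at most one exponent per triangle is 2. The default 0 also serves triangles
   without one; there [twice] exceeds the demand, which is harmless for covering, while [0 < w i]
   forces equality. *)
pose w i : nat := if (mu i 1 <= 2)%N then 1 else if (mu i 2 <= 2)%N then 2 else 0.
have w3 i : (w i < 3)%N by rewrite /w; case: ifP => // _; case: ifP.
have wE i j : (i < 4)%N -> (j < 3)%N ->
    (4 - mu i j <= twice w i j)%N /\ ((0 < w i)%N -> (4 - mu i j = twice w i j)%N).
  move=> /mu8 + j3; move: (mu3 i 0%N) (mu3 i 1%N) (mu3 i 2%N); rewrite /twice /w.
  case: ifP => [?|?]; [|case: ifP => ?];
    by case: j j3 => [|[|[|]]] //= _ *; lia.
have [c4|[w0 nc4]] := H4_dichotomy w3.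
  by apply: colorable_covered c4 _ => v; rewrite muE; case: (wE v.1 v.2).
(* All [w i] are positive here, so the demands are exact, and the cover of [x_{0,0} x^m] yields the
   excluded colouring. *)
case/negP: nc4; apply: covered_colorable (cov (ord0, ord0)) _ => v.
rewrite mnmDE mnm1E (inj_eq enum_rank_inj) muE.
have [_ <-] := wE v.1 v.2 (ltn_ord _) (ltn_ord _); last exact: w0.
rewrite subnDA leq_sub2l //; case: v => i j.
by rewrite xpair_eqE !(eq_sym ord0).
Qed.

End H4Covers.

(** * The maximal ideal is associated to [J^3] but not to [J^4] *)

Theorem theorem3p2 (k : fieldType) :
  ~ persistence_property (cover_ideal k H4) /\
  (exists s : nat, (1 <= s)%N /\
     ~ Ass_subset (ideal_exp (cover_ideal k H4) s)
                  (ideal_exp (cover_ideal k H4) s.+1)).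
Proof.
set J := cover_ideal k H4; pose P (p : {mpoly k[#|H4_vertex|]}) := p@_0%MM = 0.
suff notsub : ~ Ass_subset (ideal_exp J 3) (ideal_exp J 4).
  by split; [move/(_ 3%N isT) | exists 3%N].
have AssP : Ass (ideal_exp J 3) P.
  split; first exact: mcoeff0_prime.
  (* With three transversals, exponent 2 leaves demand 1 at every vertex. *)
  pose m2 : 'X_{1..#|H4_vertex|} := [multinom 2%N | i < #|H4_vertex|].
  exists 'X_[m2] => p; rewrite colon_principal; last exact: ideal_exp_ideal.
  rewrite ideal_exp_coverP; split=> [p0 m|cov_p].
    rewrite (perm_mem (msuppMX _ _)) => /mapP[m' m'p ->].
    (* A nonconstant [m'] raises some exponent to at least 3; the demand there vanishes and
       criticality applies. *)
    have /existsP[i m'i] : [exists i, (0 < m' i)%N].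
      apply: contraLR m'p; rewrite negb_exists => /forallP m'0.
      suff -> : m' = 0%MM by rewrite mcoeff_msupp p0 eqxx.
      by apply/mnmP => i; rewrite mnmE; apply/eqP; rewrite -leqn0 leqNgt m'0.
    pose v := enum_val i.
    have v1I : (v.1 : nat) \in iota 0 4 by rewrite mem_iota ltn_ord.
    have v2I : (v.2 : nat) \in iota 0 3 by rewrite mem_iota ltn_ord.
    apply: colorable_covered (allP (allP H4_3crit _ v1I) _ v2I) _ => u.
    rewrite mnmDE mnmE leq_subLR.
    have [<-|uv] := eqVneq v u; first by rewrite /v enum_valK; lia.
    suff -> : (u.1 == v.1 :> nat) && (u.2 == v.2 :> nat) = false by lia.
    by apply: contraNF uv => /andP[/eqP/val_inj u1 /eqP/val_inj u2];
      rewrite [u]surjective_pairing u1 u2 -surjective_pairing.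
  apply/eqP; apply: contraNT H4_not3col => p0.
  have /covered_colorable : covered H4 3 m2.
    apply: cov_p; rewrite (perm_mem (msuppMX _ _)); apply/mapP; exists 0%MM.
      by rewrite mcoeff_msupp.
    by rewrite addm0.
  by apply=> v; rewrite mnmE.
move=> /(_ _ AssP)[_ [f fP]].
have idJ4 := ideal_exp_ideal J 4.
have [_ n1 _] : prime_ideal P by case: AssP.
(* It suffices that [f] itself lies in [J^4], since then 1 lies in [P]. *)
apply: n1; apply/fP; apply/colon_principal => //.
rewrite mul1r; apply/ideal_exp_coverP => m mf; apply: covered4_of_succ => v.
(* As [x_v] lies in [P], the monomial [x_v x^m] of [x_v f] is covered. *)
have /fP/(colon_principal _ _ idJ4)/ideal_exp_coverP : P 'X_(enum_rank v).
  by rewrite /P mcoeffX mnm1_eq0.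
apply; rewrite mulrC (perm_mem (msuppMX _ _)); apply/mapP; exists m => //.
by rewrite addmC.
Qed.
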